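(* Let $p$ and $q$ be positive integers. For every hypergraph $\mathcal H$ the following statements are equivalent: (i) $\mathcal H$ is hereditary $(p,q)$-Helly; (ii) $\mathcal H$ is $(p,q')$-Helly for every integer $q'\geq q$; (iii) $\mathcal H$ is strong $(p,q)$-Helly; (iv) every partial hypergraph of $\mathcal H$ having exactly $p+1$ edges is strong $(p,q)$-Helly; (v) $\varPhi_q(\mathcal H)$ is hereditary $p$-Helly; (vi) an incidence matrix $M(\mathcal H)$ of $\mathcal H$ contains no incidence matrix of $\mathcal J_{p+1,q,s}$ as a submatrix, for any $s\in\{0,\ldots,q-1\}$; (vii) no partial subhypergraph of $\mathcal H$ is isomorphic to $\mathcal J_{p+1,q,s}$ for any $s\in\{0,\ldots,q-1\}$; (viii) for each $s\in\{0,\ldots,q-1\}$, each subset $U$ of $V(\mathcal H)$ with $|U|=(p+1)(q-s)+s$, and each $p+1$ pairwise disjoint $(q-s)$-subsets $T_1,\ldots,T_{p+1}$ of $U$ such that each of $U-T_1,\ldots,U-T_{p+1}$ is contained in some edge of $\mathcal H$, the basis $\mathcal S=\{T_1\cup Z,\ldots,T_{p+1}\cup Z\}$, where $Z=U-(T_1\cup\cdots\cup T_{p+1})$, satisfies $\mathrm{core}(\mathcal H_{\mathcal S}^\cup)\cap(T_1\cup\cdots\cup T_{p+1})\neq\emptyset$; (ix) for each nontrivial starlike $(p+1,q)$-basis $\mathcal S$ of $\mathcal H$, $\mathrm{core}(\mathcal H^\cup_{\mathcal S})\cap\mathrm{ext}(\mathcal S)\neq\emptyset$; (x) for each starlike $(p+1,q)$-basis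 $\mathcal S$ of $\mathcal H$, either $\mathcal H_{\mathcal S}^\cup$ is empty (has no edges) or $\mathrm{core}(\mathcal H_{\mathcal S}^\cup)\cap\mathrm{ext}(\mathcal S)\neq\emptyset$.
   Context: A hypergraph $\mathcal H$ is a pair $(X,\mathcal E)$ where $X=V(\mathcal H)$ is a finite set and $\mathcal E=E(\mathcal H)$ is a finite family (repetitions allowed) of nonempty subsets of $X$ (the edges) whose union is $X$; a hypergraph is identified with its edge family. The core of a family of sets is the intersection of all its members. A $k$-set is a set of cardinality $k$, a $k^+$-set one of cardinality at least $k$. A family of sets is $(p,q)$-intersecting if every nonempty subfamily of at most $p$ members has core of cardinality at least $q$; a family has the $(p,q)$-Helly property if every nonempty $(p,q)$-intersecting subfamily has core of cardinality at least $q$. A hypergraph is $(p,q)$-Helly if its edge family has the $(p,q)$-Helly property; $p$-Helly means $(p,1)$-Helly. A partial hypergraph of $\mathcal H$ is a hypergraph whose edge family is a subfamily of $E(\mathcal H)$. For $X'\subseteq V(\mathcal H)$, the subhypergraph induced by $X'$ has vertex set $X'$ and edges the nonempty sets $E\cap X'$, $E\in E(\mathcal H)$. A partial subhypergraph is a partial hypergraph of a subhypergraph. $\mathcal H$ is hereditary $(p,q)$-Helly if every subhypergraph of $\mathcal H$ is $(p,q)$-Helly; hereditary $p$-Helly means hereditary $(p,1)$-Helly. $\mathcal H$ is strong $(p,q)$-Helly if for every nonempty $(p,q)$-intersecting partial hypergraph $\mathcal H'$ of $\mathcal H$ there is a nonempty subfamily of at most $p$ edges of $\mathcal H'$ whose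 core equals $\mathrm{core}(\mathcal H')$. For a set $S$, $\varphi_q(S)$ is the set of $q$-subsets of $S$. $\varPhi_q(\mathcal H)$ is the hypergraph whose vertices are the $q$-subsets of $V(\mathcal H)$ contained in some edge of $\mathcal H$ and whose edges are the sets $\varphi_q(E)$ for the edges $E$ of $\mathcal H$ with $|E|\ge q$. An incidence matrix of $\mathcal H$ is a $(0,1)$-matrix with one row per edge and one column per vertex, with a $1$ exactly when the edge contains the vertex. For $s\in\{0,\ldots,q-1\}$, $\mathcal J_{p+1,q,s}$ is the hypergraph (unique up to isomorphism) with $(p+1)(q-s)+s$ vertices and $p+1$ edges $V-T_1,\ldots,V-T_{p+1}$, where $V$ is its vertex set and $T_1,\ldots,T_{p+1}$ are pairwise disjoint $(q-s)$-subsets of $V$. A $(p+1,q)$-basis of $\mathcal H$ is a family $\mathcal S$ of $p+1$ pairwise different $q$-subsets of $V(\mathcal H)$; its support sets are the unions of all but exactly one member of $\mathcal S$; $\mathcal H_{\mathcal S}^\cup$ is the partial hypergraph of $\mathcal H$ formed by the edges containing some support set of $\mathcal S$. $\mathcal S$ is nontrivial if every support set is contained in some edge of $\mathcal H$. $\mathcal S$ is starlike if every vertex belonging to at least two members of $\mathcal S$ belongs to $\mathrm{core}(\mathcal S)$; $\mathrm{ext}(\mathcal S)$ is the set of vertices belonging to some member of $\mathcal S$ but not to $\mathrm{core}(\mathcal S)$. *)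

(* Defs.v *)
From mathcomp Require Import all_boot matrix.
Set Implicit Arguments. Unset Strict Implicit. Unset Printing Implicit Defensive.

(* A finite family of sets (repetitions allowed) is a sequence
   considered up to permutation; its subfamilies are its subsequences.  All the
   predicates below are invariant under permutation of the families. *)

(* The intersection over the empty family is [setT] by convention; cores are
   only ever used for nonempty families. *)
Definition core (T : finType) (F : seq {set T}) : {set T} :=
  \bigcap_(E <- F) E.

Definition intersecting (T : finType) (p q : nat) (F : seq {set T}) : Prop :=
  forall G : seq {set T},
    subseq G F -> G != [::] -> size G <= p -> q <= #|core G|.

Definition Helly_property (T : finType) (p q : nat) (F : seq {set T}) : Prop :=
  forall G : seq {set T},
    subseq G F -> G != [::] -> intersecting p q G -> q <= #|core G|.

(* As the edges cover the vertex set, the latter is determined by the edge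
   family (see [vert]); [T] is only an ambient type of potential vertices. *)
Record hypergraph (T : finType) := Hypergraph {
  edges :> seq {set T};
  edges_neq0 : set0 \notin edges
}.

Definition vert (T : finType) (H : hypergraph T) : {set T} :=
  \bigcup_(E <- H) E.

Definition Helly (T : finType) (p q : nat) (H : hypergraph T) : Prop :=
  Helly_property p q H.

Definition partial_hypergraph (T : finType) (H' H : hypergraph T) : Prop :=
  subseq H' H.

Lemma induced_neq0 (T : finType) (H : hypergraph T) (X : {set T}) :
  set0 \notin [seq E <- [seq E :&: X | E <- H] | E != set0].
Proof. by rewrite mem_filter eqxx. Qed.

Definition induced (T : finType) (H : hypergraph T) (X : {set T}) :
    hypergraph T :=
  Hypergraph (induced_neq0 H X).

Definition hereditary_Helly (T : finType) (p q : nat) (H : hypergraph T) : Prop :=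
  forall X : {set T}, X \subset vert H -> Helly p q (induced H X).

Definition strong_Helly (T : finType) (p q : nat) (H : hypergraph T) : Prop :=
  forall H' : hypergraph T,
    partial_hypergraph H' H -> edges H' != [::] -> intersecting p q H' ->
    exists G : seq {set T},
      [/\ subseq G H', G != [::], size G <= p & core G = core H'].

Definition qsubsets (T : finType) (q : nat) (A : {set T}) : {set {set T}} :=
  [set B : {set T} | B \subset A & #|B| == q].

Lemma Phi_neq0 (T : finType) (q : nat) (H : hypergraph T) :
  set0 \notin [seq qsubsets q E | E : {set T} <- [seq E : {set T} <- H | q <= #|E|]].
Proof.
apply/mapP => -[E]; rewrite mem_filter => /andP[qE _] /esym/eqP.
by rewrite -cards_eq0 cards_draws -leqn0 leqNgt bin_gt0 qE.
Qed.

(* Its vertices, i.e. the elements of the edges, are exactly the q-subsets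
   contained in some edge of H. *)
Definition Phi (T : finType) (q : nat) (H : hypergraph T) :
    hypergraph {set T} :=
  Hypergraph (Phi_neq0 q H).

(* The rows and the columns are indexed by arbitrary enumerations of the edge
   family and of the vertex set. *)
Definition incidence_matrix (T : finType) (H : hypergraph T) (m n : nat)
    (M : 'M[nat]_(m, n)) : Prop :=
  exists (es : m.-tuple {set T}) (vs : n.-tuple T),
    [/\ perm_eq es H,
        perm_eq vs (enum (vert H)) &
        forall i j, M i j = nat_of_bool (tnth vs j \in tnth es i)].

Lemma incidence_matrix_exists (T : finType) (H : hypergraph T) :
  exists M : 'M[nat]_(size H, size (enum (vert H))), incidence_matrix H M.
Proof.
exists (\matrix_(i, j) nat_of_bool
          (tnth (in_tuple (enum (vert H))) j \in tnth (in_tuple H) i))%R.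
by exists (in_tuple H), (in_tuple (enum (vert H))); split=> // i j; rewrite mxE.
Qed.

Definition is_submatrix (m' n' m n : nat)
    (N : 'M[nat]_(m', n')) (M : 'M[nat]_(m, n)) : Prop :=
  exists (f : 'I_m' -> 'I_m) (g : 'I_n' -> 'I_n),
    [/\ {homo f : i j / i < j}, {homo g : i j / i < j} & N = mxsub f g M].

(* [f] is a map on the subtype of actual vertices of [H], not on the whole
   ambient type. *)
Definition isomorphic (T T' : finType) (H : hypergraph T) (H' : hypergraph T') :
    Prop :=
  exists f : {x : T | x \in vert H} -> T',
    [/\ injective f,
        f @: [set: {x : T | x \in vert H}] = vert H' &
        perm_eq [seq f @: [set x : {x : T | x \in vert H} | val x \in E]
                   | E : {set T} <- H] H'].

(* The vertices [inl (i, k)] form the set T_i of cardinality q - s, and the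
   vertices [inr z] are the s vertices outside all the T_i. *)
Definition J_vertex (p q s : nat) : finType :=
  ('I_p.+1 * 'I_(q - s) + 'I_s)%type.

Definition J_T (p q s : nat) (i : 'I_p.+1) : {set J_vertex p q s} :=
  [set inl (i, k) | k : 'I_(q - s)].

Lemma J_neq0 (p q : nat) (p_gt0 : 0 < p) (s : 'I_q) :
  set0 \notin [seq [set: J_vertex p q s] :\: J_T q s i | i <- enum 'I_p.+1].
Proof.
apply/mapP => -[i _ /setP E].
have [j ji] : exists j : 'I_p.+1, j != i.
  case: (unliftP ord0 i) => [i' ->|->]; first by exists ord0; rewrite neq_lift.
  by exists ord_max; rewrite -val_eqE /= -lt0n.
have qs : 0 < q - s by rewrite subn_gt0.
move: (E (inl (j, Ordinal qs))); rewrite !inE andbT => /esym/negbFE/imsetP[k _].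
by case=> /eqP; rewrite (negbTE ji).
Qed.

Definition J (p q : nat) (p_gt0 : 0 < p) (s : 'I_q) :
    hypergraph (J_vertex p q s) :=
  Hypergraph (J_neq0 p_gt0 s).

Lemma card_vert_J (p q : nat) (p_gt0 : 0 < p) (s : 'I_q) :
  #|vert (J p_gt0 s)| = p.+1 * (q - s) + s.
Proof.
suff -> : vert (J p_gt0 s) = [set: J_vertex p q s].
  by rewrite cardsT card_sum card_prod !card_ord.
apply/setP => v; rewrite inE /vert.
rewrite -[_ \in _]/(v \in _) /= big_map big_enum /=.
have [j vj] : exists j : 'I_p.+1, v \notin J_T q s j.
  case: v => [[i k]|z]; last by exists ord0; apply/negP => /imsetP[].
  have [j ji] : exists j : 'I_p.+1, j != i.
    case: (unliftP ord0 i) => [i' ->|->]; first by exists ord0; rewrite neq_lift.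
    by exists ord_max; rewrite -val_eqE /= -lt0n.
  by exists j; apply/negP => /imsetP[k' _ [E _]]; rewrite E eqxx in ji.
by apply/bigcupP; exists j; rewrite // in_setD vj inE.
Qed.

Definition is_basis (T : finType) (k q : nat) (H : hypergraph T)
    (S : seq {set T}) : Prop :=
  [/\ size S = k, uniq S &
      forall A, A \in S -> A \subset vert H /\ #|A| = q].

Definition support_sets (T : finType) (S : seq {set T}) : seq {set T} :=
  [seq \bigcup_(B <- rem A S) B | A <- S].

Lemma basis_cup_neq0 (T : finType) (H : hypergraph T) (S : seq {set T}) :
  set0 \notin [seq E : {set T} <- H | has (fun B : {set T} => B \subset E) (support_sets S)].
Proof. by rewrite mem_filter negb_and edges_neq0 orbT. Qed.

Definition basis_cup (T : finType) (H : hypergraph T) (S : seq {set T}) :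
    hypergraph T :=
  Hypergraph (basis_cup_neq0 H S).

Definition nontrivial (T : finType) (H : hypergraph T) (S : seq {set T}) : Prop :=
  forall B, B \in support_sets S -> exists2 E, E \in edges H & B \subset E.

Definition starlike (T : finType) (S : seq {set T}) : Prop :=
  forall (A B : {set T}) (x : T),
    A \in S -> B \in S -> A != B -> x \in A -> x \in B -> x \in core S.

Definition ext (T : finType) (S : seq {set T}) : {set T} :=
  (\bigcup_(A <- S) A) :\: core S.

(* Main.v *)
Require Import Defs.
From mathcomp Require Import all_boot matrix.
From mathcomp Require Import zify.
Set Implicit Arguments. Unset Strict Implicit. Unset Printing Implicit Defensive.

(* All ten statements are equivalent to [redundance p q H]: if E_0, ..., E_p are
   edges of H such that the intersection R_i of the E_j with j != i has at least
   q elements for every i, then R_i \subset E_i for some i.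

   Given redundance, a shortest subfamily with the same core as a
   (p,q)-intersecting family has at most p members, which yields (i)-(iv).  If
   redundance fails for E_0, ..., E_p with intersection C, then these edges
   violate the (p,q')-Helly property for q' = max(q, |C| + 1), and their traces
   on a vertex set meeting C in at most q - 1 points violate the (p,q)-Helly
   property.  A failure of redundance is also the same as a copy of some
   J_{p+1,q,s}: with s = min(|C|, q - 1), take s points of C and q - s points of
   each R_i outside C. *)

(** * Cores, vertex sets and subsets of given size *)

Lemma coreP (T : finType) (F : seq {set T}) (x : T) :
  reflect (forall A, A \in F -> x \in A) (x \in core F).
Proof. by rewrite /core bigcap_seq; exact: bigcapP. Qed.

Lemma vertP (T : finType) (H : hypergraph T) (x : T) :
  reflect (exists2 E, E \in edges H & x \in E) (x \in vert H).
Proof. by rewrite /vert bigcup_seq; exact: bigcupP. Qed.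

Lemma sub_vert (T : finType) (H : hypergraph T) (E : {set T}) :
  E \in edges H -> E \subset vert H.
Proof. by move=> EH; apply/subsetP => x xE; apply/vertP; exists E. Qed.

Lemma subset_of_card (T : finType) (A : {set T}) (k : nat) :
  k <= #|A| -> exists2 B : {set T}, B \subset A & #|B| = k.
Proof.
move=> kA; have : 0 < #|[set B : {set T} | B \subset A & #|B| == k]|.
  by rewrite cards_draws bin_gt0.
by case/card_gt0P => B; rewrite inE => /andP[BA /eqP Bk]; exists B.
Qed.

(** * The sets R_i and redundance *)

Definition rest {T : finType} {p : nat} (E : 'I_p -> {set T}) (i : 'I_p) :
    {set T} :=
  \bigcap_(j | j != i) E j.

(** Arbitrary maps [E] may be allowed: if E_i = E_j with i != j, then R_i lies in E_j = E_i and the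
    conclusion holds at once. *)
Definition redundance {T : finType} (p q : nat) (F : seq {set T}) : Prop :=
  forall E : 'I_p.+1 -> {set T},
    (forall i, E i \in F) -> (forall i, q <= #|rest E i|) ->
    exists i, rest E i \subset E i.

Lemma rest_sub {T : finType} {p : nat} (E : 'I_p -> {set T}) (i j : 'I_p) :
  j != i -> rest E i \subset E j.
Proof. by move=> ji; apply: bigcap_inf. Qed.

Lemma bigcap_sub_rest {T : finType} {p : nat} (E : 'I_p -> {set T}) (i : 'I_p) :
  \bigcap_j E j \subset rest E i.
Proof. by apply/bigcapsP => j _; exact: bigcap_inf. Qed.

Lemma ord_other (p : nat) (i : 'I_p.+1) : 0 < p -> exists j, j != i.
Proof.
move=> p_gt0; case: (unliftP ord0 i) => [i' ->|->].
  by exists ord0; rewrite neq_lift.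
by exists ord_max; rewrite -val_eqE /= -lt0n.
Qed.

(** * From redundance to few members with the same core *)

Definition del {A : Type} (i : nat) (s : seq A) : seq A :=
  take i s ++ drop i.+1 s.

Lemma del_subseq {A : eqType} (i : nat) (s : seq A) : subseq (del i s) s.
Proof.
rewrite -{2}(cat_take_drop i s) cat_subseq // -addn1 addnC -drop_drop.
exact: drop_subseq.
Qed.

Lemma size_del {A : Type} (i : nat) (s : seq A) :
  i < size s -> size (del i s) = (size s).-1.
Proof. by move=> lt_is; rewrite size_cat size_drop size_take lt_is; lia. Qed.

Lemma nth_del {A : eqType} (x0 : A) (i j : nat) (s : seq A) :
  j != i -> j < size s -> nth x0 s j \in del i s.
Proof.
move=> ji js; rewrite mem_cat; case: (ltngtP j i) ji => // lt_ji _.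
  by rewrite -(nth_take x0 lt_ji) mem_nth // size_take; case: ifP => // _.
apply/orP; right; have -> : j = i.+1 + (j - i.+1) by lia.
by rewrite -nth_drop mem_nth // size_drop; lia.
Qed.

Lemma strong_of_redundance {T : finType} (p q : nat) (F G : seq {set T}) :
  0 < p -> redundance p q F -> subseq G F -> G != [::] -> intersecting p q G ->
  exists G', [/\ subseq G' G, G' != [::], size G' <= p & core G' = core G].
Proof.
move=> p_gt0 redF sGF G0 intG.
(* [n] bounds the excess of [size K] over [p]; each round deletes one member without changing the
   core. *)
suff main n (K : seq {set T}) : size K <= n + p -> subseq K G -> K != [::] ->
    core K = core G ->
    exists G', [/\ subseq G' G, G' != [::], size G' <= p & core G' = core G].
  by apply: (main (size G) G) => //; rewrite leq_addr.
elim: n K => [|n IH] K szK sKG K0 coreK; first by exists K.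
have [leKp|ltpK] := leqP (size K) p; first by exists K.
pose E (i : 'I_p.+1) := nth set0 K i.
have ltiK (i : 'I_p.+1) : i < size K by apply: leq_trans ltpK.
have EF i : E i \in F.
  by apply: (mem_subseq sGF); apply: (mem_subseq sKG); exact: mem_nth.
have [|i redi] := redF E EF.
  (* [L] consists of the first p+1 members of [K] without the i-th. It has p members, so its core,
     which lies in R_i, has at least q elements. *)
  move=> i; set L := del i (take p.+1 K).
  have szT : size (take p.+1 K) = p.+1 by rewrite size_takel.
  have szL : size L = p by rewrite size_del szT.
  have sLG : subseq L G.
    by apply: subseq_trans (del_subseq _ _) (subseq_trans (take_subseq _ _) sKG).
  have L0 : L != [::] by rewrite -size_eq0 szL -lt0n.
  apply: leq_trans (intG L sLG L0 _) _; first by rewrite szL.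
  apply: subset_leq_card; apply/subsetP => x /coreP xL.
  apply/bigcapP => j ji; apply: xL.
  by rewrite /E -(nth_take set0 (ltn_ord j)) nth_del // szT.
apply: (IH (del i K)).
- by rewrite size_del // -ltnS prednK // (leq_trans _ ltpK).
- exact: subseq_trans (del_subseq _ _) sKG.
- by rewrite -size_eq0 size_del // -lt0n -ltnS prednK ?(leq_trans _ ltpK).
rewrite -coreK; apply/setP => x; apply/coreP/coreP => xK A AK; last first.
  by apply: xK; exact: mem_subseq (del_subseq _ _) _ AK.
have xEi : x \in E i.
  apply: (subsetP redi); apply/bigcapP => j ji; apply: xK.
  exact: nth_del.
(* A member [A] of [K] either occurs first at position [i], so that it is E_i, or it survives the
   deletion. *)
have [lt_AK /esym nthA] : index A K < size K /\ nth set0 K (index A K) = A.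
  by rewrite index_mem AK nth_index.
have [Ai|Ai] := eqVneq (index A K) i; first by rewrite nthA Ai.
by apply: xK; rewrite nthA; exact: nth_del.
Qed.

(** * From Helly properties to redundance *)

Lemma rest_sub_core {T : finType} {p : nat} (E : 'I_p.+1 -> {set T})
    (G : seq {set T}) :
  {subset G <= codom E} -> size G <= p -> exists i, rest E i \subset core G.
Proof.
(* [h] chooses an index for each member of [G]; the default [ord0] only concerns sets that are no
   E_i. At most p members use at most p indices, so some [i] is missed and every member is an E_j
   with j != i. *)
move=> GE szG; pose h A := odflt ord0 [pick i | E i == A].
have Eh A : A \in G -> E (h A) = A.
  move/GE/codomP => [i ->]; rewrite /h; case: pickP => [j /eqP //|/(_ i)].
  by rewrite eqxx.
have [i hi] : exists i, i \notin map h G.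
  apply/existsP; rewrite -negb_forall; apply/forallP => allh.
  have := card_size (map h G); rewrite size_map leqNgt.
  by rewrite (eq_card (B := predT)) ?card_ord ?ltnS ?szG // => i; rewrite allh.
exists i; apply/subsetP => x xi; apply/coreP => A AG; rewrite -(Eh A AG).
have hAi : h A != i by apply: contraNneq hi => <-; exact: map_f.
exact: (subsetP (rest_sub E hAi)).
Qed.

Lemma intersecting_codom {T : finType} {p : nat} (q : nat)
    (E : 'I_p.+1 -> {set T}) (G : seq {set T}) :
  {subset G <= codom E} -> (forall i, q <= #|rest E i|) -> intersecting p q G.
Proof.
move=> GE qE K sKG _ szK.
have [|i /subset_leq_card leiK] := rest_sub_core (E := E) _ szK.
  by move=> A /(mem_subseq sKG)/GE.
exact: leq_trans leiK.
Qed.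

Lemma core_codom {T : finType} {p : nat} (E : 'I_p -> {set T})
    (G : seq {set T}) :
  G =i codom E -> core G = \bigcap_i E i.
Proof.
move=> GE; apply/setP => x; apply/coreP/bigcapP => [xG i _|xE A].
  by apply: xG; rewrite GE codom_f.
by rewrite GE => /codomP[i ->]; exact: xE.
Qed.

Lemma Helly_of_redundance {T : finType} (p q q' : nat) (F : seq {set T}) :
  0 < p -> q <= q' -> redundance p q F -> Helly_property p q' F.
Proof.
move=> p_gt0 le_qq' redF G sGF G0 intG.
have [|K [sKG K0 szK <-]] := strong_of_redundance p_gt0 redF sGF G0.
  by move=> K sKG K0 szK; apply: leq_trans (intG K sKG K0 szK).
exact: intG.
Qed.

(** This strict gap makes the threshold |C| + 1 admissible and guarantees a point of each R_i
    outside C. *)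
Lemma card_bigcap_rest {T : finType} {p : nat} (E : 'I_p -> {set T}) i :
  ~~ (rest E i \subset E i) -> #|\bigcap_j E j| < #|rest E i|.
Proof.
move=> Ei; apply: proper_card; rewrite (bigD1 i) //= properEneq subsetIr andbT.
by apply: contraNneq Ei => <-; exact: subsetIl.
Qed.

Lemma redundance_contra {T : finType} (p q : nat) (F : seq {set T}) :
  (forall E : 'I_p.+1 -> {set T}, (forall i, E i \in F) ->
    (forall i, q <= #|rest E i|) -> (forall i, ~~ (rest E i \subset E i)) ->
    False) ->
  redundance p q F.
Proof.
move=> noE E EF qE; apply/existsP; apply: contraT => /existsPn nE.
by case: (noE E).
Qed.

(** [E] lists edges in arbitrary order, possibly with repetitions. Filtering [F] instead gives a
    true subsequence with the same members, hence the same core. *)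
Lemma filter_codom {T : finType} {p : nat} (E : 'I_p -> {set T})
    (F : seq {set T}) :
  (forall i, E i \in F) -> [seq A <- F | A \in codom E] =i codom E.
Proof.
move=> EF A; rewrite mem_filter; case: codomP => //= -[i ->]; exact: EF.
Qed.

Lemma nonempty_codom {T : finType} {p : nat} (E : 'I_p.+1 -> {set T})
    (G : seq {set T}) : G =i codom E -> G != [::].
Proof.
by move=> GE; apply/eqP => G0; have := codom_f E ord0; rewrite -GE G0.
Qed.

Lemma redundance_of_Helly {T : finType} (p q : nat) (F : seq {set T}) :
  (forall q', q <= q' -> Helly_property p q' F) -> redundance p q F.
Proof.
move=> HF; apply: redundance_contra => E EF qE nE.
pose q' := maxn q #|\bigcap_i E i|.+1.
have GE := filter_codom EF.
have intG : intersecting p q' [seq A <- F | A \in codom E].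
  apply: (intersecting_codom (E := E)) => [A|i]; first by rewrite GE.
  by rewrite geq_max qE card_bigcap_rest.
have := HF q' (leq_maxl _ _) _ (filter_subseq _ _) (nonempty_codom GE) intG.
by rewrite (core_codom GE) geq_max ltnn andbF.
Qed.

(** * Hereditary Helly hypergraphs *)

Lemma redundance_of_hereditary {T : finType} (p q : nat) (H : hypergraph T) :
  0 < p -> 0 < q -> hereditary_Helly p q H -> redundance p q H.
Proof.
move=> p_gt0 q_gt0 HH; apply: redundance_contra => E EF qE nE.
set C := \bigcap_i E i.
have [Z ZC cardZ] := subset_of_card (geq_minl #|C| q.-1).
(* [X] drops all of C except the points of [Z]. *)
pose X := vert H :&: (~: C :|: Z); pose E' i := E i :&: X.
have qE' i : q <= #|rest E' i|.
  have sub : (rest E i :\: C) :|: Z \subset rest E' i.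
    apply/subsetP => x; rewrite !inE => xZ; apply/bigcapP => j ji.
    have xEj : x \in E j.
      case/orP: xZ => [/andP[_]|/(subsetP ZC)/bigcapP/(_ j)]; last exact.
      exact: (subsetP (rest_sub E ji)).
    rewrite !inE xEj (subsetP (sub_vert (EF j))) //=.
    by case/orP: xZ => [/andP[->]|->] //; rewrite orbT.
  (* If |C| < q, then [Z] is C and all |R_i| points of R_i remain; otherwise q - 1 points of C
     remain, and the gap supplies at least one point outside C. *)
  apply: leq_trans (subset_leq_card sub).
  have CE : C \subset rest E i := bigcap_sub_rest E i.
  rewrite cardsU [_ :&: Z](_ : _ = set0); last first.
    apply/setP => x; rewrite !inE; apply/negbTE; apply/negP.
    by case/andP => /andP[/negP nC _] /(subsetP ZC).
  have := card_bigcap_rest (nE i); rewrite -/C.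
  rewrite cards0 cardsD (setIidPr CE) cardZ.
  by have := qE i; rewrite /minn; case: ifP; lia.
have E'F i : E' i \in edges (induced H X).
  rewrite mem_filter; apply/andP; split; last by apply/mapP; exists (E i).
  (* The trace of E_i is nonempty because it contains the whole R'_j for any j != i. *)
  have [j ji] := ord_other i p_gt0.
  rewrite -card_gt0; apply: leq_trans q_gt0 (leq_trans (qE' j) _).
  by apply: subset_leq_card; apply: rest_sub; rewrite eq_sym.
have GE := filter_codom E'F.
have intG : intersecting p q [seq A <- induced H X | A \in codom E'].
  by apply: (intersecting_codom (E := E')) => [A|//]; rewrite GE.
have := HH X (subsetIl _ _) _ (filter_subseq _ _) (nonempty_codom GE) intG.
rewrite (core_codom GE) => le_q.
suff /subset_leq_card : \bigcap_i E' i \subset Z by lia.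
apply/subsetP => x /bigcapP xE.
have xC : x \in C.
  by apply/bigcapP => i _; have := xE i isT; rewrite inE => /andP[].
by have := xE ord0 isT; rewrite !inE xC => /and3P[].
Qed.

(** Lifting the traces to edges of [H] can only enlarge the R_i, so redundance of [H] applies. The
    smaller R'_i lies in [X] because, as p > 0, it is contained in some other trace. *)
Lemma redundance_induced {T : finType} (p q : nat) (H : hypergraph T)
    (X : {set T}) :
  0 < p -> redundance p q H -> redundance p q (induced H X).
Proof.
move=> p_gt0 redH E' E'F qE'.
have /fin_all_exists[E EE'] i : exists A, A \in edges H /\ E' i = A :&: X.
  by have := E'F i; rewrite mem_filter => /andP[_ /mapP[A]]; exists A.
have restE i : rest E' i \subset rest E i.
  apply/subsetP => x /bigcapP xE; apply/bigcapP => j /xE.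
  by rewrite (proj2 (EE' j)) inE => /andP[].
have [i|i|i redi] := redH E; first by case: (EE' i).
  exact: leq_trans (qE' i) (subset_leq_card (restE i)).
exists i; rewrite (proj2 (EE' i)) subsetI (subset_trans (restE i) redi) /=.
have [j ji] := ord_other i p_gt0.
by apply: subset_trans (rest_sub E' ji) _; rewrite (proj2 (EE' j)) subsetIr.
Qed.

Lemma hereditaryP {T : finType} (p q : nat) (H : hypergraph T) :
  0 < p -> 0 < q -> hereditary_Helly p q H <-> redundance p q H.
Proof.
move=> p_gt0 q_gt0; split; first exact: redundance_of_hereditary.
move=> redH X _; apply: (Helly_of_redundance (q := q)) => //.
exact: redundance_induced.
Qed.

(** The map [qsubsets q] commutes with intersections, is nonempty exactly on sets with at least q
    elements, and on these reflects inclusion. The two conditions thus translate into each other. *)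
Lemma redundance_Phi {T : finType} (p q : nat) (H : hypergraph T) :
  0 < p -> 0 < q -> redundance p 1 (Phi q H) <-> redundance p q H.
Proof.
move=> p_gt0 q_gt0.
have qsub_sub (A B : {set T}) :
    q <= #|A| -> qsubsets q A \subset qsubsets q B -> A \subset B.
  move=> qA /subsetP sAB; apply/subsetP => x xA.
  (* Any point [x] of [A] is completed by q - 1 further points to a q-subset of [A], which must then
     lie in [B]. *)
  have [|D] := @subset_of_card _ (A :\ x) q.-1.
    by have := cardsD1 x A; rewrite xA; lia.
  rewrite subsetD1 => /andP[DA xD] cardD.
  have := sAB (x |: D); rewrite !inE subUset sub1set xA DA cardsU1 xD cardD.
  rewrite add1n prednK // eqxx => /(_ isT)/andP[/subsetP sDB _].
  by apply: sDB; rewrite setU11.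
have qsub_card (A : {set T}) : (0 < #|qsubsets q A|) = (q <= #|A|).
  by rewrite cards_draws bin_gt0.
have qsub_rest (E : 'I_p.+1 -> {set T}) i :
    rest (fun j => qsubsets q (E j)) i = qsubsets q (rest E i).
  apply/setP => B; rewrite !inE; apply/bigcapP/andP => [BE|[BE cB] j ji].
    split; last first.
      by have [j /BE] := ord_other i p_gt0; rewrite inE => /andP[].
    by apply/bigcapsP => j /BE; rewrite inE => /andP[].
  by rewrite inE cB (subset_trans BE) // rest_sub.
split=> red E EF qE.
  have [i|i|i] := red (fun j => qsubsets q (E j)).
  - apply: map_f; rewrite mem_filter EF andbT.
    have [j ji] := ord_other i p_gt0; apply: leq_trans (qE j) _.
    by apply: subset_leq_card; rewrite rest_sub // eq_sym.
  - by rewrite qsub_rest qsub_card.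
  by rewrite qsub_rest => /(qsub_sub _ _ (qE i)); exists i.
have /fin_all_exists[D ED] i : exists A, A \in edges H /\ E i = qsubsets q A.
  have := EF i => /mapP[A]; rewrite mem_filter => /andP[_ AH] ->.
  by exists A.
have restE i : rest E i = qsubsets q (rest D i).
  by rewrite -qsub_rest; apply: eq_bigr => j _; case: (ED j).
have [i|i|i redi] := red D; first by case: (ED i).
  by rewrite -qsub_card -restE.
exists i; rewrite restE (proj2 (ED i)); apply/subsetP => B.
by rewrite !inE => /andP[/subset_trans->].
Qed.


(** A violation has pairwise different E_i, so taking each once gives exactly p+1 edges. If p of
    them or fewer had core C, they would miss an index i, whence R_i lies in C and so in E_i. *)
Lemma redundance_of_strong {T : finType} (p q : nat) (H : hypergraph T) :
  (forall H' : hypergraph T,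
     partial_hypergraph H' H -> size (edges H') = p.+1 ->
     strong_Helly p q H') ->
  redundance p q H.
Proof.
move=> HH; apply: redundance_contra => E EH qE nE.
have E_inj : injective E.
  move=> i j eq_ij; apply/eqP; apply: contraT; rewrite eq_sym => ji.
  by have := nE i; rewrite eq_ij rest_sub.
have EuH i : E i \in undup H by rewrite mem_undup.
set F := [seq A <- undup H | A \in codom E].
have FE : F =i codom E := filter_codom EuH.
have sF : subseq F H.
  exact: subseq_trans (filter_subseq _ _) (undup_subseq _).
have F0 : set0 \notin F by apply: contra (edges_neq0 H); exact: mem_subseq.
have szF : size F = p.+1.
  have /perm_size-> : perm_eq F (codom E).
    by apply: uniq_perm => //; [exact/filter_uniq/undup_uniq | exact/injectiveP].
  by rewrite size_codom card_ord.
have [||K [sK _ szK coreK]] := HH (Hypergraph F0) sF szF _ (subseq_refl _).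
- exact: nonempty_codom FE.
- by apply: (intersecting_codom (E := E)) => // A; rewrite FE.
have [|i] := rest_sub_core (E := E) _ szK.
  by move=> A /(mem_subseq sK); rewrite FE.
rewrite coreK (core_codom FE) => ri; have := nE i.
by rewrite (subset_trans ri) // (bigcap_inf i).
Qed.

(** * Embedded copies of J_{p+1,q,s}, the common form of (vi) and (vii) *)

Definition J_embedding {T : finType} {p q s : nat} (F : seq {set T})
    (E : 'I_p.+1 -> {set T}) (g : J_vertex p q s -> T) : Prop :=
  [/\ forall i, E i \in F, injective g &
      forall i v, (g v \in E i) = (v \notin J_T q s i)].

Lemma inl_J_T (p q s : nat) (i j : 'I_p.+1) (k : 'I_(q - s)) :
  ((inl (j, k) : J_vertex p q s) \in J_T q s i) = (j == i).
Proof.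
by apply/imsetP/eqP => [[l _ [-> _]]|->]; last by exists k.
Qed.

Lemma inr_J_T (p q s : nat) (i : 'I_p.+1) (z : 'I_s) :
  ((inr z : J_vertex p q s) \in J_T q s i) = false.
Proof. by apply/imsetP => -[]. Qed.

Lemma J_T_other {p q s : nat} (v : J_vertex p q s) :
  0 < p -> exists i, v \notin J_T q s i.
Proof.
move=> p_gt0; case: v => [[j k]|z]; last by exists ord0; rewrite inr_J_T.
by have [i ij] := ord_other j p_gt0; exists i; rewrite inl_J_T eq_sym.
Qed.

Lemma vert_J (p q : nat) (p_gt0 : 0 < p) (s : 'I_q) :
  vert (J p_gt0 s) = [set: J_vertex p q s].
Proof.
apply/eqP; rewrite eqEcard subsetT card_vert_J cardsT card_sum card_prod.
by rewrite !card_ord leqnn.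
Qed.

(** As s < q, each T_i is nonempty, and its image is missed by E_i alone. Taking [X] full separates
    the edges; taking the image of [g] separates their traces. *)
Lemma embedding_inj {T : finType} {p q : nat} {s : 'I_q} (F : seq {set T})
    (E : 'I_p.+1 -> {set T}) (g : J_vertex p q s -> T) (X : {set T}) :
  J_embedding F E g -> (forall v, g v \in X) -> injective (fun i => E i :&: X).
Proof.
move=> [_ _ gE] gX i j /setP Eij; have s0 : 0 < q - s by rewrite subn_gt0.
have := Eij (g (inl (i, Ordinal s0))).
by rewrite !inE !gE gX !inl_J_T eqxx /= !andbT => /esym/negbFE/eqP.
Qed.

Lemma redundance_of_no_embedding {T : finType} (p q : nat) (F : seq {set T}) :
  0 < q ->
  (forall (s : 'I_q) (E : 'I_p.+1 -> {set T}) (g : J_vertex p q s -> T),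
     ~ J_embedding F E g) ->
  redundance p q F.
Proof.
move=> q_gt0 noJ; apply: redundance_contra => E EF qE nE.
set C := \bigcap_i E i.
have lt_s : minn #|C| q.-1 < q by rewrite /minn; case: ifP; lia.
pose s := Ordinal lt_s.
have [Z ZC cardZ] := subset_of_card (geq_minl #|C| q.-1).
(* Enough points exist: if s = |C|, then R_i has at least q - |C| points outside C; if s = q - 1,
   one point suffices. *)
have /fin_all_exists2[R RE cardR] i :
    exists2 B : {set T}, B \subset rest E i :\: C & #|B| = q - s.
  apply: subset_of_card.
  have CE : C \subset rest E i := bigcap_sub_rest E i.
  rewrite cardsD (setIidPr CE); have := card_bigcap_rest (nE i).
  by rewrite -/C /=; have := qE i; rewrite /minn; case: ifP; lia.
pose g (v : J_vertex p q s) : T :=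
  match v with
  | inl (i, k) => enum_val (cast_ord (esym (cardR i)) k)
  | inr z => enum_val (cast_ord (esym cardZ) z)
  end.
have gE i v : (g v \in E i) = (v \notin J_T q s i).
  case: v => [[j k]|z]; last first.
    rewrite inr_J_T /=.
    by have /(subsetP ZC)/bigcapP-> := enum_valP (cast_ord (esym cardZ) z).
  rewrite inl_J_T /=.
  have := enum_valP (cast_ord (esym (cardR j)) k).
  move: (enum_val _) => x /(subsetP (RE j)); rewrite inE => /andP[xC xj].
  have [ji|ji] := eqVneq j i; last first.
    by rewrite (subsetP (rest_sub E _) x xj) // eq_sym.
  (* A point of R_j already lies in all other edges, so lying in E_j too would put it in C. *)
  apply: contraNF xC => xi; apply/bigcapP => l _.
  have [->//|li] := eqVneq l i; apply: (subsetP (rest_sub E _) x xj).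
  by rewrite ji.
apply: (noJ s E g); split=> // -[[i k]|z] [[j l]|y] eq_g.
- have := gE j (inl (i, k)); rewrite eq_g gE !inl_J_T eqxx => /esym/negbFE/eqP ij.
  by subst j; move: eq_g => /enum_val_inj/cast_ord_inj->.
- by have := gE i (inl (i, k)); rewrite eq_g gE inl_J_T inr_J_T eqxx.
- by have := gE j (inr z); rewrite eq_g gE inl_J_T inr_J_T eqxx.
- by move: eq_g => /enum_val_inj/cast_ord_inj->.
Qed.

(** T_i and the s central vertices map to (q - s) + s = q points of R_i, while the image of T_i
    avoids E_i. *)
Lemma no_embedding_of_redundance {T : finType} (p q : nat) (F : seq {set T})
    (s : 'I_q) (E : 'I_p.+1 -> {set T}) (g : J_vertex p q s -> T) :
  redundance p q F -> ~ J_embedding F E g.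
Proof.
move=> redF [EF g_inj gE].
pose h i (x : 'I_(q - s) + 'I_s) : T :=
  g (match x with inl k => inl (i, k) | inr z => inr z end).
have h_inj i : injective (h i) by move=> [k|z] [l|y] /g_inj // [->].
have hE i x : h i x \in rest E i.
  apply/bigcapP => j ji; rewrite gE; case: x => [k|z].
    by rewrite inl_J_T eq_sym.
  by rewrite inr_J_T.
have [i|i /subsetP redi] := redF E EF.
  have -> : q = #|[set h i x | x : 'I_(q - s) + 'I_s]|.
    by rewrite (card_imset _ (h_inj i)) card_sum !card_ord subnK // ltnW.
  by apply: subset_leq_card; apply/subsetP => _ /imsetP[x _ ->].
have s0 : 0 < q - s by rewrite subn_gt0.
by have := redi _ (hE i (inl (Ordinal s0))); rewrite gE inl_J_T eqxx.
Qed.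

(** * Submatrices of incidence matrices *)

Lemma perm_map_enum {A B : finType} (f : A -> B) :
  injective f -> #|B| <= #|A| -> perm_eq (map f (enum A)) (enum B).
Proof.
move=> f_inj leBA; have [f' f'K fK] := inj_card_bij f_inj leBA.
apply: uniq_perm => [||x]; first by rewrite map_inj_uniq // enum_uniq.
  exact: enum_uniq.
by rewrite mem_enum -[x]fK map_f // mem_enum.
Qed.

(** Submatrices keep the order of rows and columns, so these are selected through the increasing
    enumeration of a set of indices. *)
Lemma enum_val_homo {n : nat} (A : {set 'I_n}) :
  {homo (fun i : 'I_#|A| => enum_val i) : i j / i < j}.
Proof.
move=> i j ltij; have x0 := enum_val i.
rewrite (enum_val_nth x0 i) (enum_val_nth x0 j).
have srt : sorted (relpre val ltn) (enum A).
  rewrite /enum_mem sorted_filter //; first by move=> ? ? ?; exact: ltn_trans.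
  by rewrite -enumT -sorted_map val_enum_ord iota_ltn_sorted.
apply: (sorted_ltn_nth _ _ srt) => //; rewrite ?inE -?cardE //.
by move=> ? ? ?; exact: ltn_trans.
Qed.

Lemma submatrix_of_embedding {T : finType} (p q : nat) (p_gt0 : 0 < p)
    (H : hypergraph T) (m n : nat) (M : 'M[nat]_(m, n)) (s : 'I_q)
    (E : 'I_p.+1 -> {set T}) (g : J_vertex p q s -> T) :
  incidence_matrix H M -> J_embedding H E g ->
  exists m' n' (N : 'M[nat]_(m', n')),
    incidence_matrix (J p_gt0 s) N /\ is_submatrix N M.
Proof.
move=> [es [vs [pes pvs ME]]] emb; have [EH g_inj gE] := emb.
have /fin_all_exists[r rE] i : exists a, tnth es a = E i.
  by have := EH i; rewrite -(perm_mem pes) => /tnthP[a ->]; exists a.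
have /fin_all_exists[c cg] v : exists b, tnth vs b = g v.
  have [i vi] := J_T_other v p_gt0.
  have : g v \in vert H by rewrite (subsetP (sub_vert (EH i))) // gE.
  by rewrite -mem_enum -(perm_mem pvs) => /tnthP[b ->]; exists b.
have r_inj : injective r.
  move=> i j rij; apply: (embedding_inj emb (X := setT)) => [v|].
    by rewrite inE.
  by rewrite /= -!rE rij.
have c_inj : injective c by move=> v w cvw; apply: g_inj; rewrite -!cg cvw.
pose R := [set r i | i : 'I_p.+1]; pose C := [set c v | v : J_vertex p q s].
(* [r'] and [c'] tell which edge and vertex of [J] the sorted rows and columns stand for; they
   provide the enumerations witnessing that the submatrix is an incidence matrix of [J]. *)
have /fin_all_exists[r' rr'] (a : 'I_#|R|) : exists i, r i = enum_val a.
  by have /imsetP[i _ ->] := enum_valP a; exists i.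
have /fin_all_exists[c' cc'] (b : 'I_#|C|) : exists v, c v = enum_val b.
  by have /imsetP[v _ ->] := enum_valP b; exists v.
have r'_inj : injective r'.
  by move=> a b eq_ab; apply: enum_val_inj; rewrite -!rr' eq_ab.
have c'_inj : injective c'.
  by move=> a b eq_ab; apply: enum_val_inj; rewrite -!cc' eq_ab.
exists #|R|, #|C|,
  (mxsub (fun a : 'I_#|R| => enum_val a) (fun b : 'I_#|C| => enum_val b) M).
split; last first.
  exists (fun a : 'I_#|R| => enum_val a), (fun b : 'I_#|C| => enum_val b).
  by split=> //; exact: enum_val_homo.
exists [tuple [set: J_vertex p q s] :\: J_T q s (r' a) | a < #|R|],
  [tuple c' b | b < #|C|].
split.
- rewrite /= /J /= (map_comp (fun i => [set: J_vertex p q s] :\: J_T q s i) r').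
  by rewrite perm_map // perm_map_enum // !card_ord card_imset ?card_ord.
- rewrite vert_J enum_setT -enumT /= perm_map_enum //.
  by rewrite card_ord card_imset.
move=> a b; rewrite mxE !tnth_mktuple ME -rr' -cc' rE cg gE.
by rewrite !inE andbT.
Qed.

Lemma embedding_of_submatrix {T : finType} (p q : nat) (p_gt0 : 0 < p)
    (H : hypergraph T) (m n m' n' : nat) (M : 'M[nat]_(m, n))
    (N : 'M[nat]_(m', n')) (s : 'I_q) :
  incidence_matrix H M -> incidence_matrix (J p_gt0 s) N ->
  is_submatrix N M ->
  exists (E : 'I_p.+1 -> {set T}) (g : J_vertex p q s -> T), J_embedding H E g.
Proof.
move=> [es [vs [pes pvs ME]]] [es' [vs' [pes' pvs' NJ]]] [f [g [_ g_homo NM]]].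
have /fin_all_exists[a aJ] i : exists a, tnth es' a = setT :\: J_T q s i.
  have : setT :\: J_T q s i \in es'.
    by rewrite (perm_mem pes'); apply: map_f; rewrite mem_enum.
  by case/tnthP => a ->; exists a.
have /fin_all_exists[b bJ] v : exists b, tnth vs' b = v.
  have : v \in vs' by rewrite (perm_mem pvs') vert_J mem_enum inE.
  by case/tnthP => b ->; exists b.
exists (fun i => tnth es (f (a i))), (fun v => tnth vs (g (b v))).
split=> [i|v w|i v].
- by rewrite -(perm_mem pes) mem_tnth.
(* Different columns carry different vertices, and the strictly increasing column selection [g]
   never repeats a column. *)
- have vs_uniq : uniq vs by rewrite (perm_uniq pvs) enum_uniq.
  move/(tuple_uniqP _ vs_uniq) => gvw; rewrite -(bJ v) -(bJ w).
  have [lt|lt|/val_inj -> //] := ltngtP (b v) (b w).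
    by have := g_homo _ _ lt; rewrite gvw ltnn.
  by have := g_homo _ _ lt; rewrite gvw ltnn.
have := NJ (a i) (b v); rewrite NM mxE ME aJ bJ !inE andbT.
by case: (_ \in _); case: (_ \notin _).
Qed.

(** * Partial subhypergraphs isomorphic to J_{p+1,q,s} *)

Lemma isomorphic_of_embedding {T : finType} (p q : nat) (p_gt0 : 0 < p)
    (H : hypergraph T) (s : 'I_q)
    (E : 'I_p.+1 -> {set T}) (g : J_vertex p q s -> T) :
  J_embedding H E g ->
  exists (X : {set T}) (H' : hypergraph T),
    [/\ X \subset vert H, partial_hypergraph H' (induced H X) &
        isomorphic H' (J p_gt0 s)].
Proof.
move=> emb; have [EH g_inj gE] := emb.
pose X := [set g v | v : J_vertex p q s]; pose E' i := E i :&: X.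
have gX v : g v \in X by apply: imset_f.
have E'_inj : injective E' := embedding_inj emb gX.
have gE' i v : (g v \in E' i) = (v \notin J_T q s i) by rewrite inE gX andbT gE.
(* Several edges of [H] may have the same trace on [X]; [undup] keeps one copy, so that exactly p+1
   edges remain. *)
pose F := [seq A <- undup (induced H X) | A \in codom E'].
have sF : subseq F (induced H X).
  exact: subseq_trans (filter_subseq _ _) (undup_subseq _).
have F0 : set0 \notin F.
  by apply: contra (edges_neq0 (induced H X)); exact: mem_subseq.
have E'H i : E' i \in undup (induced H X).
  rewrite mem_undup mem_filter (map_f (fun A => A :&: X)) // andbT.
  have [j ji] := ord_other i p_gt0; have s0 : 0 < q - s by rewrite subn_gt0.
  apply/set0Pn; exists (g (inl (j, Ordinal s0))).
  by rewrite gE' inl_J_T.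
have FE' := filter_codom E'H.
pose H' := Hypergraph F0.
have vertX : vert H' = X.
  apply/eqP; rewrite eqEsubset; apply/andP; split; apply/subsetP => x.
    by case/vertP => A; rewrite FE' => /codomP[i ->]; rewrite inE => /andP[].
  case/imsetP => v _ ->; have [i vi] := J_T_other v p_gt0.
  by apply/vertP; exists (E' i); rewrite ?FE' ?codom_f // gE'.
exists X, H'; split=> //.
  apply/subsetP => _ /imsetP[v _ ->]; have [i vi] := J_T_other v p_gt0.
  by rewrite (subsetP (sub_vert (EH i))) // gE.
(* The isomorphism [f] is the inverse of [g] on its image. *)
have /fin_all_exists[f gf] (x : {x : T | x \in vert H'}) :
    exists v, g v = val x.
  have : val x \in X by rewrite -vertX (valP x).
  by case/imsetP => v _ ->; exists v.
exists f; split.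
- by move=> x y fxy; apply: val_inj; rewrite -!gf fxy.
- apply/setP => v; rewrite vert_J inE.
  have gv : g v \in vert H' by rewrite vertX.
  by apply/imsetP; exists (Sub (g v) gv) => //; apply: g_inj; rewrite gf.
have pF : perm_eq F [seq E' i | i <- enum 'I_p.+1].
  apply: uniq_perm => //; rewrite ?filter_uniq ?undup_uniq //.
  by rewrite map_inj_uniq ?enum_uniq.
apply: perm_trans (perm_map _ pF) _; rewrite -map_comp.
rewrite (eq_map (_ : _ =1 (fun i => setT :\: J_T q s i))) // => i.
apply/setP => v; rewrite !inE andbT -gE'; apply/imsetP/idP => [[x]|gv].
  by rewrite inE => xi ->; rewrite gf.
have gv' : g v \in vert H' by rewrite vertX.
exists (Sub (g v) gv'); first by rewrite inE.
by apply: g_inj; rewrite gf.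
Qed.

Lemma embedding_of_isomorphic {T : finType} (p q : nat) (p_gt0 : 0 < p)
    (H H' : hypergraph T) (X : {set T}) (s : 'I_q) :
  partial_hypergraph H' (induced H X) -> isomorphic H' (J p_gt0 s) ->
  exists (E : 'I_p.+1 -> {set T}) (g : J_vertex p q s -> T), J_embedding H E g.
Proof.
move=> sH' [f [f_inj f_onto pJ]].
have H'X D : D \in edges H' -> exists2 A, A \in edges H & D = A :&: X.
  by move/(mem_subseq sH'); rewrite mem_filter => /andP[_ /mapP].
have /fin_all_exists2[E EH Ef] i : exists2 A, A \in edges H &
    forall x, (val x \in A) = (f x \notin J_T q s i).
  have : setT :\: J_T q s i \in edges (J p_gt0 s).
    by apply: map_f; rewrite mem_enum.
  rewrite -(perm_mem pJ) => /mapP[D DH' JD]; have [A AH DA] := H'X D DH'.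
  exists A => // x; have /setP/(_ (f x)) := JD.
  rewrite (mem_imset _ _ f_inj) !inE andbT => ->; rewrite DA inE.
  (* Every vertex of [H'] lies in [X], so for it membership in the edge [A] and in the trace of [A]
     agree. *)
  have /vertP[B /H'X[A' _ ->]] := valP x.
  by rewrite inE => /andP[_ ->]; rewrite andbT.
have /fin_all_exists[h hK] v : exists x, f x = v.
  have : v \in f @: setT by rewrite f_onto vert_J inE.
  by case/imsetP => x _ ->; exists x.
exists E, (fun v => val (h v)); split=> // [v w /val_inj hvw|i v].
  by rewrite -(hK v) hvw hK.
by rewrite Ef hK.
Qed.

(** * Bases and their support sets *)

Lemma extP (T : finType) (S : seq {set T}) (x : T) :
  reflect ((exists2 A, A \in S & x \in A) /\ x \notin core S) (x \in ext S).
Proof.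
rewrite inE andbC bigcup_seq.
by apply: (iffP andP) => -[H ?]; split=> //; exact/bigcupP.
Qed.

(** [rem] deletes a single copy; uniqueness of [S] turns this into the condition B != A. *)
Lemma support_subP (T : finType) (S : seq {set T}) (A E : {set T}) :
  uniq S ->
  reflect (forall B, B \in S -> B != A -> B \subset E)
          (\bigcup_(B <- rem A S) B \subset E).
Proof.
move=> S_uniq; rewrite bigcup_seq; apply: (iffP bigcupsP) => SE B.
  by move=> BS BA; apply: SE; rewrite mem_rem_uniq // inE BA.
by rewrite mem_rem_uniq // inE => /andP[BA BS]; exact: SE.
Qed.

Lemma basis_cupP (T : finType) (H : hypergraph T) (S : seq {set T})
    (E : {set T}) :
  uniq S ->
  reflect (E \in edges H /\
           exists2 A, A \in S & forall B, B \in S -> B != A -> B \subset E)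
          (E \in edges (basis_cup H S)).
Proof.
move=> S_uniq; rewrite mem_filter andbC.
apply: (iffP andP) => -[EH EP]; split=> //.
  have [_ /mapP[A AS ->] /(support_subP _ _ S_uniq)] := hasP EP.
  by exists A.
have [A AS AE] := EP; apply/hasP; exists (\bigcup_(B <- rem A S) B).
  exact: (map_f (fun A => \bigcup_(B <- rem A S) B)).
exact/support_subP.
Qed.

(* An edge of [basis_cup H S] avoiding part of the [i]-th member of [S] must
   contain all the other members.  If for every [i] there is such an edge, then
   these [p.+1] edges contradict redundance. *)
Lemma basis_of_redundance (T : finType) (p q : nat) (H : hypergraph T)
    (S : seq {set T}) :
  0 < p -> redundance p q H -> is_basis p.+1 q H S ->
  core (basis_cup H S) :&: ext S != set0.
Proof.
move=> p_gt0 redH [szS S_uniq SH]; apply/negP => /eqP core0.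
pose A (i : 'I_p.+1) := nth set0 S i.
have lti (i : 'I_p.+1) : i < size S by rewrite szS.
have AS i : A i \in S by exact: mem_nth.
have A_inj i j : A i = A j -> i = j.
  by move/eqP; rewrite nth_uniq // => /eqP/val_inj.
have /fin_all_exists2[E EH nAE] i :
    exists2 E, E \in edges (basis_cup H S) & ~~ (A i \subset E).
  apply/hasP; apply: contraT => /hasPn allE.
  have [j ji] := ord_other i p_gt0.
  (* If all edges contained A_i, a point of A_i outside [core S] would lie in the empty
     intersection. Such a point exists: otherwise A_i lies in A_j, and equal cardinalities give A_i
     = A_j. *)
  suff /subsetPn[x xA xS] : ~~ (A i \subset core S).
    have := in_set0 x; rewrite -core0 inE => /negbT/negP[]; apply/andP; split.
      by apply/coreP => E /allE/negPn/subsetP; apply.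
    by apply/extP; split=> //; exists (A i).
  apply: contra ji => /subsetP AC; apply/eqP/esym/A_inj/eqP.
  rewrite eqEcard (proj2 (SH _ (AS i))) (proj2 (SH _ (AS j))) leqnn andbT.
  by apply/subsetP => x /AC/coreP; exact.
have AE i j : j != i -> A j \subset E i.
  move=> ji; have /(basis_cupP _ _ S_uniq)[_ [B BS BE]] := EH i.
  have BAi : B = A i.
    apply/eqP; apply: contraNT (nAE i) => BAi.
    by apply: BE; rewrite // eq_sym.
  by apply: BE => //; rewrite BAi; apply: contra ji => /eqP/A_inj->.
have Arest i : A i \subset rest E i.
  by apply/bigcapsP => j ji; apply: AE; rewrite eq_sym.
have [i|i|i redi] := redH E.
- by have /(basis_cupP _ _ S_uniq)[] := EH i.
- by rewrite -(proj2 (SH _ (AS i))) subset_leq_card.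
by have := nAE i; rewrite (subset_trans (Arest i) redi).
Qed.

Lemma nontrivial_basis_cup (T : finType) (H : hypergraph T) (S : seq {set T}) :
  S != [::] -> nontrivial H S -> edges (basis_cup H S) != [::].
Proof.
case: S => // A S _ /(_ _ (mem_head _ _))[E EH sE].
apply/eqP => E0; have := in_nil E; rewrite -E0 mem_filter EH andbT.
by move/hasP; case; eexists; first exact: mem_head.
Qed.

(** * Sunflowers with petals T_i and kernel Z *)

Definition sunflower {T : finType} {p : nat} (Ts : 'I_p.+1 -> {set T})
    (Z : {set T}) : seq {set T} :=
  [seq Ts i :|: Z | i <- enum 'I_p.+1].

Section Sunflower.
Variables (T : finType) (p : nat) (Ts : 'I_p.+1 -> {set T}) (Z : {set T}).
Hypothesis Ts_neq0 : forall i, Ts i != set0.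
Hypothesis disjTs : forall i j, i != j -> [disjoint Ts i & Ts j].
Hypothesis disjZ : forall i, [disjoint Ts i & Z].

Let S := sunflower Ts Z.

Lemma sunflowerP (A : {set T}) :
  reflect (exists i, A = Ts i :|: Z) (A \in S).
Proof.
by apply: (iffP mapP) => [[i _ ->]|[i ->]]; exists i; rewrite ?mem_enum.
Qed.

Lemma mem_sunflower i : Ts i :|: Z \in S.
Proof. by apply/sunflowerP; exists i. Qed.

Lemma sunflower_inj : injective (fun i => Ts i :|: Z).
Proof.
move=> i j /setP eq_ij; have /set0Pn[x xi] := Ts_neq0 i.
apply/eqP; apply: contraT => /disjTs/disjointFr/(_ xi) xj.
by have := eq_ij x; rewrite !inE xi xj (disjointFr (disjZ i) xi).
Qed.

Lemma sunflower_uniq : uniq S.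
Proof. by rewrite (map_inj_uniq sunflower_inj) enum_uniq. Qed.

Lemma sunflower_core : Z \subset core S.
Proof.
apply/subsetP => x xZ; apply/coreP => _ /sunflowerP[i ->].
by rewrite inE xZ orbT.
Qed.

Lemma sunflower_starlike : starlike S.
Proof.
move=> _ _ x /sunflowerP[i ->] /sunflowerP[j ->] ij.
rewrite !inE => /orP[xi|xZ] /orP[xj|xZ']; try exact: (subsetP sunflower_core).
have /disjTs/disjointFr/(_ xi) : i != j by apply: contraNneq ij => ->.
by rewrite xj.
Qed.

Lemma sunflower_ext : ext S \subset \bigcup_i Ts i.
Proof.
apply/subsetP => x /extP[[_ /sunflowerP[i ->]]]; rewrite inE.
case/orP => [xi _|/(subsetP sunflower_core)-> //].
by apply/bigcupP; exists i.
Qed.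

Lemma sunflower_cup (H : hypergraph T) (E : {set T}) i :
  E \in edges H -> (forall j, j != i -> Ts j :|: Z \subset E) ->
  E \in edges (basis_cup H S).
Proof.
move=> EH sE; apply/(basis_cupP _ _ sunflower_uniq); split=> //.
exists (Ts i :|: Z); first exact: mem_sunflower.
by move=> _ /sunflowerP[j ->] ji; apply: sE; apply: contraNneq ji => ->.
Qed.

Lemma sunflower_nontrivial (H : hypergraph T) :
  (forall i, exists2 E, E \in edges H &
     forall j, j != i -> Ts j :|: Z \subset E) ->
  nontrivial H S.
Proof.
move=> HE _ /mapP[_ /sunflowerP[i ->] ->]; have [E EH sE] := HE i.
exists E => //; apply/(support_subP _ _ sunflower_uniq) => _ /sunflowerP[j ->].
by move=> ji; apply: sE; apply: contraNneq ji => ->.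
Qed.

End Sunflower.

(* Statement (viii) of the theorem. *)
Definition disjoint_bases {T : finType} (p q : nat) (H : hypergraph T) : Prop :=
  forall (s : 'I_q) (U : {set T}) (Ts : 'I_p.+1 -> {set T}),
      U \subset vert H -> #|U| = p.+1 * (q - s) + s ->
      (forall i, Ts i \subset U /\ #|Ts i| = q - s) ->
      (forall i j, i != j -> [disjoint Ts i & Ts j]) ->
      (forall i, exists2 E, E \in edges H & U :\: Ts i \subset E) ->
      core (basis_cup H (sunflower Ts (U :\: \bigcup_i Ts i))) :&:
        \bigcup_i Ts i != set0.

(** The sets of (viii) form a sunflower, hence a starlike basis, and its [ext] lies in the union of
    the petals. *)
Lemma disjoint_bases_of_starlike {T : finType} (p q : nat) (H : hypergraph T) :
  0 < p ->
  (forall S : seq {set T},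
     is_basis p.+1 q H S -> nontrivial H S -> starlike S ->
     core (basis_cup H S) :&: ext S != set0) ->
  disjoint_bases p q H.
Proof.
move=> p_gt0 starH s U Ts UH cardU TsU disjTs HE.
set Z := U :\: _.
have disjZ i : [disjoint Ts i & Z].
  rewrite -setI_eq0; apply/eqP/setP => x; rewrite !inE.
  by apply/negP => /and3P[xi /negP[]]; apply/bigcupP; exists i.
have Ts0 i : Ts i != set0.
  by rewrite -card_gt0 (proj2 (TsU i)) subn_gt0.
(* The petals are disjoint and nonempty, hence distinct, and cover (p+1)(q-s) points of [U]; thus s
   points remain and every T_i with [Z] has q elements. *)
have cardZ : #|Z| = s.
  have sTU : \bigcup_i Ts i \subset U by apply/bigcupsP => i _; case: (TsU i).
  have tri : trivIset [set Ts i | i : 'I_p.+1].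
    apply/trivIsetP => _ _ /imsetP[i _ ->] /imsetP[j _ ->] ij.
    by apply: disjTs; apply: contraNneq ij => ->.
  have Ts_inj : injective Ts.
    move=> i j eq_ij; apply/eqP; apply: contraT => /disjTs.
    by rewrite eq_ij -setI_eq0 setIid (negbTE (Ts0 j)).
  have : #|\bigcup_i Ts i| = p.+1 * (q - s).
    have -> : \bigcup_i Ts i = cover [set Ts i | i : 'I_p.+1].
      by rewrite cover_imset.
    rewrite -(eqP tri) big_imset /=; last by move=> i j _ _; exact: Ts_inj.
    rewrite (eq_bigr (fun=> q - s)) => [|i _]; last by case: (TsU i).
    by rewrite sum_nat_const card_ord.
  by move=> cardT; rewrite cardsD (setIidPr sTU) cardU cardT addKn.
have sub i j : j != i -> Ts j :|: Z \subset U :\: Ts i.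
  move=> ji; rewrite subUset !subsetD subsetDl (proj1 (TsU j)) disjTs //=.
  by rewrite disjoint_sym disjZ.
apply: contra (starH (sunflower Ts Z) _ _ _).
- rewrite -!subset0; apply: subset_trans; apply: setIS.
  exact: sunflower_ext.
- split.
  + by rewrite size_map size_enum_ord.
  + exact: sunflower_uniq.
  move=> _ /sunflowerP[i ->]; split.
    rewrite (subset_trans _ UH) // subUset subsetDl.
    by case: (TsU i) => ->.
  by rewrite cardsU disjoint_setI0 // cards0 subn0 cardZ (proj2 (TsU i)) subnK
    // ltnW.
- apply: sunflower_nontrivial => // i; have [E EH UE] := HE i.
  by exists E => // j ji; apply: subset_trans (sub i j ji) UE.
exact: sunflower_starlike.
Qed.

(** For an embedded copy of [J], the edge E_i contains U - T_i, so it belongs to [basis_cup]. A core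
    point in T_i would lie in E_i, which avoids T_i. *)
Lemma redundance_of_disjoint_bases {T : finType} (p q : nat)
    (H : hypergraph T) :
  0 < p -> 0 < q -> disjoint_bases p q H -> redundance p q H.
Proof.
move=> p_gt0 q_gt0 HB; apply: redundance_of_no_embedding => // s E g emb.
have [EH g_inj gE] := emb.
pose U := [set g v | v : J_vertex p q s]; pose Ts i := g @: J_T q s i.
have gTs i v : (g v \in Ts i) = (v \in J_T q s i) by apply: mem_imset.
have TsU i : Ts i \subset U.
  by apply/subsetP => _ /imsetP[v _ ->]; exact: imset_f.
have disjTs i j : i != j -> [disjoint Ts i & Ts j].
  move=> ij; rewrite -setI_eq0; apply/eqP/setP => x; rewrite !inE.
  apply/negP => /andP[/imsetP[_ /imsetP[k _ ->] ->]].
  by rewrite gTs inl_J_T (negbTE ij).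
have cardT i : #|Ts i| = q - s.
  rewrite (card_imset _ g_inj) card_imset ?card_ord // => k l.
  by case.
have UE i : U :\: Ts i \subset E i.
  apply/subsetP => x; rewrite inE => /andP[xi /imsetP[v _ xv]].
  by move: xi; rewrite xv gTs gE.
have UH : U \subset vert H.
  apply/subsetP => _ /imsetP[v _ ->]; have [i vi] := J_T_other v p_gt0.
  by rewrite (subsetP (sub_vert (EH i))) // gE.
have cardU : #|U| = p.+1 * (q - s) + s.
  by rewrite card_imset // card_sum card_prod !card_ord.
have HE i : exists2 D, D \in edges H & U :\: Ts i \subset D by exists (E i).
have TsP i : Ts i \subset U /\ #|Ts i| = q - s by [].
have /set0Pn[x] := HB s U Ts UH cardU TsP disjTs HE.
set Z := U :\: _; rewrite inE => /andP[/coreP xcore /bigcupP[i _ xi]].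
have disjZ j : [disjoint Ts j & Z].
  rewrite -setI_eq0; apply/eqP/setP => y; rewrite !inE.
  by apply/negP => /and3P[yj /negP[]]; apply/bigcupP; exists j.
have /xcore : E i \in edges (basis_cup H (sunflower Ts Z)).
  apply: (sunflower_cup _ disjTs disjZ (i := i)) => // j.
    by rewrite -card_gt0 cardT subn_gt0.
  move=> ji; apply: subset_trans (UE i); rewrite subUset !subsetD subsetDl.
  by rewrite disjTs // TsU disjoint_sym disjZ.
by case/imsetP: xi => v vi ->; rewrite gE vi.
Qed.

(** * The cycle of implications between the ten statements *)

Theorem theorem2p13 (p q : nat) (p_gt0 : 0 < p) (q_gt0 : 0 < q)
    (T : finType) (H : hypergraph T)
    (m n : nat) (M : 'M[nat]_(m, n)) (M_inc : incidence_matrix H M) :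
  [<->
    (* (i) *) hereditary_Helly p q H;
    (* (ii) *) forall q' : nat, q <= q' -> Helly p q' H;
    (* (iii) *) strong_Helly p q H;
    (* (iv) *) forall H' : hypergraph T,
      partial_hypergraph H' H -> size (edges H') = p.+1 -> strong_Helly p q H';
    (* (v) *) hereditary_Helly p 1 (Phi q H);
    (* (vi) *) forall (s : 'I_q) (m' n' : nat) (N : 'M[nat]_(m', n')),
      incidence_matrix (J p_gt0 s) N -> ~ is_submatrix N M;
    (* (vii) *) forall (s : 'I_q) (X : {set T}) (H' : hypergraph T),
      X \subset vert H -> partial_hypergraph H' (induced H X) ->
      ~ isomorphic H' (J p_gt0 s);
    (* (viii) *) forall (s : 'I_q) (U : {set T}) (Ts : 'I_p.+1 -> {set T}),
      U \subset vert H -> #|U| = p.+1 * (q - s) + s ->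
      (forall i, Ts i \subset U /\ #|Ts i| = q - s) ->
      (forall i j, i != j -> [disjoint Ts i & Ts j]) ->
      (forall i, exists2 E, E \in edges H & U :\: Ts i \subset E) ->
      let Z := U :\: \bigcup_i Ts i in
      let S := [seq Ts i :|: Z | i <- enum 'I_p.+1] in
      core (basis_cup H S) :&: \bigcup_i Ts i != set0;
    (* (ix) *) forall S : seq {set T},
      is_basis p.+1 q H S -> nontrivial H S -> starlike S ->
      core (basis_cup H S) :&: ext S != set0;
    (* (x) *) forall S : seq {set T},
      is_basis p.+1 q H S -> starlike S ->
      edges (basis_cup H S) = [::] \/ core (basis_cup H S) :&: ext S != set0 ].
Proof.
have p1 : redundance p q H <-> redundance p 1 (Phi q H).
  by split=> /(redundance_Phi H p_gt0 q_gt0).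
have red_viii : disjoint_bases p q H -> redundance p q H.
  exact: redundance_of_disjoint_bases.
have ix_viii := @disjoint_bases_of_starlike T p q H p_gt0.
tfae.
- move/(hereditaryP H p_gt0 q_gt0) => redH q' le_qq'.
  exact: Helly_of_redundance redH.
- move/redundance_of_Helly => redH H' sH' H'0.
  exact: strong_of_redundance redH sH' H'0.
- move=> strongH H' sH' _ K sK; apply: strongH; exact: subseq_trans sH'.
- move=> iv; apply/hereditaryP/p1 => //; exact: redundance_of_strong.
- move/(hereditaryP _ p_gt0 (ltn0Sn 0))/p1 => redH s m' n' N NJ NM.
  have [E [g]] := embedding_of_submatrix M_inc NJ NM.
  exact: no_embedding_of_redundance.
- move=> vi; have redH : redundance p q H.
    apply: redundance_of_no_embedding => // s E g emb.
    have [m' [n' [N [NJ NM]]]] := submatrix_of_embedding p_gt0 M_inc emb.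
    exact: vi NJ NM.
  move=> s X H' _ sH' iso; have [E [g]] := embedding_of_isomorphic sH' iso.
  exact: no_embedding_of_redundance.
- move=> vii; have redH : redundance p q H.
    apply: redundance_of_no_embedding => // s E g emb.
    have [X [H' [XH sH' iso]]] := isomorphic_of_embedding p_gt0 emb.
    exact: (vii s X H').
  by apply: ix_viii => S SH _ _; exact: basis_of_redundance SH.
- by move/red_viii => redH S SH _ _; exact: basis_of_redundance SH.
(* Redundance gives the second alternative for every basis, so no case distinction on [basis_cup]
   arises. *)
- move=> ix S SH _; right; apply: basis_of_redundance SH => //.
  exact/red_viii/ix_viii.
(* The way back goes through (ix): for a nontrivial basis, some edge contains a support set, which
   rules out the first alternative of (x). *)
move=> x; apply/hereditaryP => //; apply/red_viii/ix_viii => S SH nS starS.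
have S0 : S != [::] by case: SH => szS _ _; rewrite -size_eq0 szS.
case: (x S SH starS) => // S_nil.
by have := nontrivial_basis_cup S0 nS; rewrite S_nil.
Qed.
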